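(* Let $M \subseteq \mathbb{R}^k$ be non-empty and closed and let $h \ge 1$ be an integer. Then the following three conditions are equivalent. (H) Every finite collection $C_1,\ldots,C_m$ ($m \ge h$) of $M$-convex sets, for which every sub-collection of $h$ elements has non-empty intersection, satisfies $C_1 \cap \cdots \cap C_m \ne \emptyset$. (A) For every collection of affine-linear functions $a_1,\ldots,a_m$ ($m \ge h$) on $\mathbb{R}^k$, either the system $a_1(x) \ge 0,\ldots,a_m(x) \ge 0$ has a solution $x \in M$ or, otherwise, there exist $1 \le i_1,\ldots,i_h \le m$ such that the system $a_{i_1}(x) \ge 0,\ldots,a_{i_h}(x) \ge 0$ has no solution $x \in M$. (B) For every collection of affine-linear functions $b_1,\ldots,b_m,c$ ($m \ge h-1$) on $\mathbb{R}^k$ such that $$\mu := \sup\{c(x) : b_1(x) \ge 0,\ldots,b_m(x) \ge 0,\ x \in M\}$$ is finite, there exist $1 \le i_1,\ldots,i_{h-1} \le m$ such that $$\mu = \sup\{c(x) : b_{i_1}(x) \ge 0,\ldots,b_{i_{h-1}}(x) \ge 0,\ x \in M\}.$$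
   Context: For a non-empty set $M \subseteq \mathbb{R}^k$, a subset $C \subseteq M$ is called $M$-convex if $C = M \cap K$ for some convex set $K \subseteq \mathbb{R}^k$ (the empty set is $M$-convex). Collections are indexed families. The indices $i_1, i_2, \ldots$ in (A) and (B) are not required to be distinct. The supremum of the empty set is $-\infty$, so it is not finite. *)

(* Defs.v *)
From mathcomp Require Import all_boot all_order all_algebra.
From mathcomp Require Import all_classical all_reals all_analysis.

Set Implicit Arguments.
Unset Strict Implicit.
Unset Printing Implicit Defensive.

Import Order.TTheory GRing.Theory Num.Theory.
Import numFieldNormedType.Exports.

Local Open Scope classical_set_scope.
Local Open Scope ring_scope.

Definition M_convex (R : realType) (k : nat) (M C : set 'rV[R]_k) : Prop :=
  exists2 K : set 'rV[R]_k, convex_set K & C = M `&` K.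

Definition affine_linear (R : realType) (k : nat) (a : 'rV[R]_k -> R) : Prop :=
  exists (l : {scalar 'rV[R]_k}) (b : R), forall x, a x = l x + b.

Definition solutions (R : realType) (k : nat) (M : set 'rV[R]_k)
    (I : Type) (a : I -> 'rV[R]_k -> R) : set 'rV[R]_k :=
  [set x | M x /\ forall i, 0 <= a i x].

(* Taken in the extended reals, so that it is -oo for an infeasible system and
   +oo when c is unbounded above. *)
Definition sup_over (R : realType) (k : nat) (M : set 'rV[R]_k)
    (I : Type) (b : I -> 'rV[R]_k -> R) (c : 'rV[R]_k -> R) : \bar R :=
  ereal_sup [set (c x)%:E | x in solutions M b].

(* The h-element sub-collections of the family C are indexed by sets of h
   distinct indices. *)
Definition condition_H (R : realType) (k : nat) (M : set 'rV[R]_k) (h : nat) :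
    Prop :=
  forall (m : nat) (C : 'I_m -> set 'rV[R]_k),
    (h <= m)%N ->
    (forall i, M_convex M (C i)) ->
    (forall J : {set 'I_m}, #|J| = h -> \bigcap_(i in [set` J]) C i !=set0) ->
    \bigcap_i C i !=set0.

(* The selected indices i are an arbitrary, possibly non-injective, map. *)
Definition condition_A (R : realType) (k : nat) (M : set 'rV[R]_k) (h : nat) :
    Prop :=
  forall (m : nat) (a : 'I_m -> 'rV[R]_k -> R),
    (h <= m)%N ->
    (forall i, affine_linear (a i)) ->
    solutions M a !=set0 \/
    exists i : 'I_h -> 'I_m, ~ (solutions M (fun j => a (i j)) !=set0).

(* Since h >= 1 is assumed throughout, h.-1 is the true difference h - 1. *)
Definition condition_B (R : realType) (k : nat) (M : set 'rV[R]_k) (h : nat) :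
    Prop :=
  forall (m : nat) (b : 'I_m -> 'rV[R]_k -> R) (c : 'rV[R]_k -> R),
    (h.-1 <= m)%N ->
    (forall i, affine_linear (b i)) ->
    affine_linear c ->
    sup_over M b c \is a fin_num ->
    exists i : 'I_h.-1 -> 'I_m,
      sup_over M b c = sup_over M (fun j => b (i j)) c.

(* Main.v *)
From HB Require Import structures.
Require Import Defs.
From mathcomp Require Import all_boot all_order all_algebra.
From mathcomp Require Import all_classical all_reals all_analysis.
From mathcomp Require Import ring lra.

(* (A) => (H): with a witness x_J for every h-element subfamily J, the i-th set
   contains the M-part of the polytope spanned by the x_J with i in J; cutting
   these polytopes into half-spaces turns the family into an affine system, all
   of whose h-subsystems are solved by some x_J.
   (A) => (B): if dropping to h - 1 constraints always raised the supremum, then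
   for mu' slightly above mu the infeasible system b >= 0, c >= mu' would have
   all its h-subsystems feasible.
   (B) => (A): a supremum that is not attained prevents a direct application of
   (B), so infeasibility is first made uniform (min_i a_i <= - d on M) by box
   constraints and compactness; then (B) bounds the size of a system that is
   minimal among those with a uniform gap. *)

Import Order.TTheory GRing.Theory Num.Theory.
Import numFieldNormedType.Exports.

Local Open Scope classical_set_scope.
Local Open Scope ring_scope.

(** * Polyhedral cones and finite hulls *)

Definition dual_cone {R : realFieldType} {n : nat} (s : seq 'cV[R]_n) :
    set 'rV[R]_n :=
  [set v | forall u, u \in s -> 0 <= (v *m u) 0 0].

(** Fourier-Motzkin elimination of [t]: functionals positive at [w] bound [t] above, those negative
    at [w] bound it below, and those vanishing at [w] do not involve it. A suitable [t] exists when
    each lower bound, 0 included, is at most each upper bound. *)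
Lemma dual_cone_add_ray {R : realFieldType} {n : nat} (s : seq 'cV[R]_n)
    (w : 'rV[R]_n) :
  exists s' : seq 'cV[R]_n, forall v,
    dual_cone s' v <-> exists2 t, 0 <= t & dual_cone s (v - t *: w).
Proof.
pose d (v : 'rV[R]_n) (u : 'cV[R]_n) := (v *m u) 0 0.
have dB v t u : d (v - t *: w) u = d v u - t * d w u.
  by rewrite /d mulmxBl -scalemxAl !mxE.
have dZB v a b p q : d v (a *: p - b *: q) = a * d v p - b * d v q.
  by rewrite /d mulmxBr -!scalemxAr !mxE.
exists ([seq u <- s | 0 <= d w u] ++
  [seq d w p *: q - d w q *: p | p <- [seq u <- s | 0 < d w u],
                                 q <- [seq u <- s | d w u < 0]]) => v; split.
- move=> sv.
  have sv0 u : u \in s -> 0 <= d w u -> 0 <= d v u.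
    by move=> us wu; apply: sv; rewrite mem_cat mem_filter wu us.
  have svpq p q : p \in s -> q \in s -> 0 < d w p -> d w q < 0 ->
      0 <= d w p * d v q - d w q * d v p.
    move=> ps qs wp wq.
    have := sv (d w p *: q - d w q *: p).
    rewrite -/(d _ _) dZB; apply.
    rewrite mem_cat; apply/orP; right; apply/allpairsP; exists (p, q).
    by rewrite !mem_filter wp wq.
  (* The largest lower bound on [t], the default 0 accounting for [0 <= t]. *)
  exists (\big[Num.max/0]_(u <- s | d w u < 0) (d v u / d w u)).
    exact: bigmax_ge_id.
  move=> u us; rewrite -/(d _ _) dB.
  have [wu|wu|wu] := ltgtP (d w u) 0.
  + by rewrite subr_ge0 -ler_ndivrMr//;
    exact: (le_bigmax_seq _ u (fun u => d w u < 0) (fun u => d v u / d w u)).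
  + rewrite subr_ge0 -ler_pdivlMr// big_seq_cond; apply: bigmax_le.
      by rewrite divr_ge0 ?(ltW wu)// sv0// ltW.
    move=> q /andP[qs wq]; rewrite ler_pdivlMr// mulrAC ler_ndivrMr//.
    by rewrite -subr_ge0 [_ * d w u]mulrC [d v u * _]mulrC svpq.
  + by rewrite wu mulr0 subr0 sv0// wu.
- move=> [t t0 sv] u; rewrite mem_cat => /orP[|/allpairsP[[p q]]] /=.
    rewrite mem_filter => /andP[wu us].
    have := sv u us; rewrite -/(d _ _) dB subr_ge0; apply: le_trans.
    by rewrite mulr_ge0.
  rewrite !mem_filter => -[/andP[wp ps] /andP[wq qs] ->].
  have := sv p ps; rewrite -/(d _ _) dB => vp.
  have := sv q qs; rewrite -/(d _ _) dB => vq.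
  rewrite -/(d _ _) dZB.
  (* The combined functional vanishes at [w], so [v] may be replaced by [v - t *: w]. *)
  have -> : d w p * d v q - d w q * d v p =
    d w p * (d v q - t * d w q) - d w q * (d v p - t * d w p) by ring.
  by rewrite subr_ge0 (@le_trans _ _ 0)// ?mulr_le0_ge0 ?mulr_ge0// ltW.
Qed.

(** Weyl's theorem, adding one ray at a time. Minimality among the sets closed under adding rays
    stands in for an explicit cone of nonnegative combinations. *)
Lemma dual_cone_generated {R : realFieldType} {n : nat} (xs : seq 'rV[R]_n) :
  exists2 s : seq 'cV[R]_n, forall x, x \in xs -> dual_cone s x &
    forall K : set 'rV[R]_n, K 0 ->
      (forall v t x, K v -> 0 <= t -> x \in xs -> K (v + t *: x)) ->
      dual_cone s `<=` K.
Proof.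
elim: xs => [|w xs [s xs_s sK]].
  (* Without generators the cone is 0, cut out by the coordinates and their opposites. *)
  exists ([seq delta_mx i 0 | i <- enum 'I_n] ++
          [seq - delta_mx i 0 | i <- enum 'I_n]) => // K K0 _ v sv.
  suff -> : v = 0 by [].
  apply/rowP => i; rewrite mxE.
  have dv : (v *m delta_mx i (0 : 'I_1)) 0 0 = v 0 i by rewrite -colE mxE.
  apply/eqP; rewrite eq_le; apply/andP; split.
    rewrite -oppr_ge0 -dv; have := sv (- delta_mx i 0).
    rewrite mulmxN mxE; apply; rewrite mem_cat; apply/orP; right.
    by apply: map_f; rewrite mem_enum.
  rewrite -dv; apply: sv; rewrite mem_cat; apply/orP; left.
  by apply: map_f; rewrite mem_enum.
have [s' s'P] := dual_cone_add_ray s w; exists s'.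
  move=> x; rewrite inE => /orP[/eqP->|xxs]; apply/s'P.
    by exists 1 => //; rewrite scale1r subrr => u _; rewrite mul0mx mxE.
  by exists 0 => //; rewrite scale0r subr0; exact: xs_s.
move=> K K0 Kxs v /s'P[t t0 sv].
rewrite -(subrK (t *: w) v); apply: (Kxs); rewrite ?mem_head//.
by apply: (sK K) => // v' t' x Kv' t'0 xxs; apply: Kxs => //; rewrite inE xxs orbT.
Qed.

(* The hull is the slice at height 1 of the cone over the points. *)
Lemma finite_hull_polyhedral {R : realType} {k : nat} (xs : seq 'rV[R]_k) :
  exists2 s : seq 'cV[R]_(k + 1),
    forall x, x \in xs -> dual_cone s (row_mx x 1%:M) &
    forall K : set 'rV[R]_k, convex_set K -> (forall x, x \in xs -> K x) ->
      forall y, dual_cone s (row_mx y 1%:M) -> K y.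
Proof.
have [s xs_s sK] := dual_cone_generated [seq row_mx x 1%:M | x <- xs].
exists s => [x xxs|K convK Kxs y sy]; first by apply: xs_s; exact: map_f.
(* The cone over [K] placed at height 1. A point of height 1 in it is not the apex and has [t = 1],
   hence comes from [K]. *)
have := sK [set v | v = 0 \/
  exists t z, [/\ 0 < t, K z & v = t *: row_mx z 1%:M]].
move=> /(_ _ _ _ sy) []; first by left.
- move=> v t x Kv t0 /mapP[z /Kxs Kz ->].
  move: t0; rewrite le_eqVlt => /predU1P[<-|t0]; first by rewrite scale0r addr0.
  case: Kv => [->|[t' [z' [t'0 Kz' ->]]]]; right.
    by rewrite add0r; exists t, z.
  have tt0 : 0 < t' + t by rewrite addr_gt0.
  have l01 : 0 <= t' / (t' + t) <= 1.
    by rewrite divr_ge0 ?(ltW t'0) ?(ltW tt0)//= ler_pdivrMr// mul1r lerDl ltW.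
  exists (t' + t), (t' / (t' + t) *: z' + (1 - t' / (t' + t)) *: z); split => //.
    have := convK z' z (Itv01 (andP l01).1 (andP l01).2).
    by rewrite !inE; apply.
  rewrite scale_row_mx scale_row_mx scale_row_mx add_row_mx.
  rewrite scalerDr !scalerA -scalerDl; congr (row_mx (_ *: _ + _ *: _) _).
  + by field; rewrite gt_eqF.
  + by field; rewrite gt_eqF.
- by move=> /eqP; rewrite row_mx_eq0 (negPf (matrix_nonzero1 _ _)) andbF.
- move=> [t [z [_ Kz]]]; rewrite scale_row_mx => /eq_row_mx[-> /matrixP/(_ 0 0)].
  by rewrite !mxE eqxx mulr1n mulr1 => <-; rewrite scale1r.
Qed.

(** * Affine functions and half-spaces *)

Lemma affine_linear_row {R : realType} {k : nat} (u : 'cV[R]_k) (b : R) :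
  affine_linear (fun x : 'rV[R]_k => (x *m u) 0 0 + b).
Proof.
pose f (x : 'rV[R]_k) := (x *m u) 0 0.
have f_lin : scalar f.
  by move=> t x y; rewrite /f mulmxDl -scalemxAl !mxE.
pose fL := GRing.isLinear.Build _ _ _ _ f f_lin.
by exists (HB.pack f fL : {scalar 'rV[R]_k}), b.
Qed.

Lemma affine_linear_shift {R : realType} {k : nat} (a : 'rV[R]_k -> R) (t : R) :
  affine_linear a -> affine_linear (fun x => a x + t).
Proof.
by move=> [l [b ab]]; exists l, (b + t) => x; rewrite ab addrA.
Qed.

Lemma affine_linear_continuous {R : realType} {k : nat} (a : 'rV[R]_k -> R) :
  affine_linear a -> continuous a.
Proof.
move=> [l [b ab]].
have -> : a = fun x => \sum_j x 0 j * l (delta_mx 0 j) + b.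
  apply/funext => x; rewrite ab {1}[x]row_sum_delta linear_sum.
  congr (_ + _); apply: eq_bigr => j _; exact: linearZ.
move=> x; apply: (@continuousD _ _ _ _ (cst b)); last exact: cst_continuous.
apply: continuous_big => [|j _ {}x]; first exact: add_continuous.
apply: (@continuousM _ _ _ (cst _)); last exact: cst_continuous.
exact: coord_continuous.
Qed.

Lemma halfspace_convex {R : realType} {k : nat} (a : 'rV[R]_k -> R) :
  affine_linear a -> convex_set [set x : 'rV[R]_k | 0 <= a x].
Proof.
move=> [l [b ab]] x y t; rewrite !inE /= => ax ay.
have -> : a (conv t x y) = t%:num * a x + (1 - t%:num) * a y.
  rewrite !ab /conv /= linearD !linearZ /= /unstable.onem; ring.
by rewrite addr_ge0// mulr_ge0// subr_ge0.
Qed.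

(** * Equivalence of (H) and (A) *)

Lemma subset_with_card {T : finType} (A : {set T}) (n : nat) :
  (#|A| <= n)%N -> (n <= #|T|)%N -> exists2 B : {set T}, A \subset B & #|B| = n.
Proof.
move=> An nT.
have /card_geqP[s [us ss sA]] : (n - #|A| <= #|~: A|)%N.
  by rewrite [leqRHS]cardsCs finset.setCK leq_sub2r.
exists (A :|: [set x in s]); first exact: finset.subsetUl.
rewrite cardsU (_ : A :&: _ = finset.set0); last first.
  apply/setP => x; rewrite !inE; apply/negbTE/andP => -[xA /sA].
  by rewrite inE xA.
by rewrite cards0 subn0 cardsE (card_uniqP us) ss subnKC.
Qed.
(** Lets half-spaces of several polytopes, or an [option] type, index the system, whatever their
    number. *)
Lemma condition_A_fin {R : realType} {k : nat} {M : set 'rV[R]_k} {h : nat} :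
  M !=set0 -> (0 < h)%N -> condition_A M h ->
  forall (I : finType) (a : I -> 'rV[R]_k -> R),
    (forall i, affine_linear (a i)) ->
    (forall f : 'I_h -> I, solutions M (fun j => a (f j)) !=set0) ->
    solutions M a !=set0.
Proof.
move=> [x0 Mx0] h0 AM I a aff feas.
have [i0 _|I0] := pickP (@predT I); last first.
  by exists x0; split => // i; have := I0 i.
(* Constant functions pad the family up to h members. *)
pose a' (t : I + 'I_h) := if t is inl i then a i else fun=> 0.
have [||[x [Mx ax]]|[f []]] := AM #|{: I + 'I_h}| (fun j => a' (enum_val j)).
- by rewrite card_sum card_ord leq_addl.
- move=> j; case: (enum_val j) => [i|j']; first exact: aff.
  have -> : a' (inr j') = fun x => (x *m (0 : 'cV[R]_k)) 0 0 + 0.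
    by apply/funext => x /=; rewrite mulmx0 mxE addr0.
  exact: affine_linear_row.
- by exists x; split => // i; have := ax (enum_rank (inl i)); rewrite enum_rankK.
(* Replacing a padding index by [i0] only strengthens the subsystem, since the padding functions are
   0. *)
have [x [Mx ax]] := feas (fun j => if enum_val (f j) is inl i then i else i0).
exists x; split => // j; have := ax j.
by case: (enum_val (f j)).
Qed.

Lemma condition_H_A {R : realType} {k : nat} (M : set 'rV[R]_k) (h : nat) :
  (0 < h)%N -> condition_H M h -> condition_A M h.
Proof.
move=> h0 HM m a hm aff.
have [|feas] := pselect (exists i : 'I_h -> 'I_m,
  ~ (solutions M (fun j => a (i j)) !=set0)); first by right.
left; have [|J cJ|x Cx] := HM m (fun i => M `&` [set x | 0 <= a i x]) hm.
- by move=> i; exists [set x | 0 <= a i x] => //; exact: halfspace_convex.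
- have [x [Mx ax]] : solutions M
      (fun j => a (enum_val (cast_ord (esym cJ) j))) !=set0.
    by apply: contrapT => nx; apply: feas; eexists; exact: nx.
  exists x => i /= iJ; split => //=.
  have := ax (cast_ord cJ (enum_rank_in iJ i)).
  by rewrite cast_ordK enum_rankK_in.
- exists x; split; last by move=> i; have [] := Cx i I.
  by have [] := Cx (Ordinal (leq_trans h0 hm)) I.
Qed.

Lemma condition_A_H {R : realType} {k : nat} (M : set 'rV[R]_k) (h : nat) :
  M !=set0 -> (0 < h)%N -> condition_A M h -> condition_H M h.
Proof.
move=> M0 h0 AM m C hm Cconv Ch.
have /choice[K KP] : forall i, exists K : set 'rV[R]_k,
    convex_set K /\ C i = M `&` K.
  by move=> i; have [K] := Cconv i; exists K.
have /choice[x xP] : forall J : {set 'I_m}, exists x,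
    #|J| = h -> forall i, i \in J -> C i x.
  move=> J; have [cJ|] := pselect (#|J| = h); last by exists 0.
  by have [x Cx] := Ch J cJ; exists x.
pose xs (i : 'I_m) := [seq x J | J : {set 'I_m} <- enum {set 'I_m} & (#|J| == h) && (i \in J)].
have xsC i y : y \in xs i -> C i y.
  by move=> /mapP[J]; rewrite mem_filter => /andP[/andP[/eqP cJ iJ] _ ->]; exact: xP.
have /choice[s sP] : forall i, exists s : seq 'cV[R]_(k + 1),
    (forall y, y \in xs i -> dual_cone s (row_mx y 1%:M)) /\
    (forall y, dual_cone s (row_mx y 1%:M) -> K i y).
  move=> i; have [s s_xs sK] := finite_hull_polyhedral (xs i); exists s; split => //.
  apply: sK => [|y /xsC]; first by have [] := KP i.
  by have [_ ->] := KP i => -[].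
pose facet (t : {i : 'I_m & 'I_(size (s i))}) (y : 'rV[R]_k) :=
  (row_mx y 1%:M *m (s (tag t))`_(tagged t)) 0 0.
have [|f|y [My yP]] := condition_A_fin M0 h0 AM _ facet.
- move=> t; pose u := (s (tag t))`_(tagged t).
  have -> : facet t = fun y => (y *m usubmx u) 0 0 + dsubmx u 0 0.
    apply/funext => y.
    by rewrite /facet -/u -{1}[u]vsubmxK mul_row_col mul1mx mxE.
  exact: affine_linear_row.
(* Several selected half-spaces may come from the same polytope, so the polytope indices are
   completed to exactly [h] elements; [x J] lies in every polytope indexed by [J]. *)
- have [J fJ cJ] : exists2 J : {set 'I_m}, [set tag (f j) | j : 'I_h] \subset J
      & #|J| = h.
    apply: subset_with_card; last by rewrite card_ord.
    by rewrite (leq_trans (leq_imset_card _ _))// card_ord.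
  have tfJ j : tag (f j) \in J by apply: (fintype.subsetP fJ); exact: imset_f.
  exists (x J); split.
    have := xP J cJ _ (tfJ (Ordinal h0)).
    by have [_ ->] := KP (tag (f (Ordinal h0))) => -[].
  move=> j; apply: (sP (tag (f j))).1; last exact: mem_nth.
  by apply: map_f; rewrite mem_filter cJ eqxx tfJ mem_enum.
- exists y => i _; have [_ ->] := KP i; split => //; apply: (sP i).2 => u us.
  have ui : (index u (s i) < size (s i))%N by rewrite index_mem.
  by have := yP (Tagged (fun i => 'I_(size (s i))) (Ordinal ui));
    rewrite /facet /= nth_index.
Qed.

(** * From (A) to (B) *)

Lemma condition_A_B {R : realType} {k : nat} (M : set 'rV[R]_k) (h : nat) :
  M !=set0 -> (0 < h)%N -> condition_A M h -> condition_B M h.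
Proof.
case: h => // h M0 h0 AM m b c /= hm affb affc mu_fin.
apply: contrapT => nB.
set mu := fine (sup_over M b c).
have muE : sup_over M b c = mu%:E by rewrite fineK.
have sol_le x : solutions M b x -> c x <= mu.
  move=> bx; rewrite -lee_fin -muE; apply: ereal_sup_ubound; exact: imageP.
have /choice[x xP] : forall f : {ffun 'I_h -> 'I_m}, exists x,
    solutions M (fun j => b (f j)) x /\ mu < c x.
  move=> f; have : (mu%:E < sup_over M (fun j => b (f j)) c)%E.
    rewrite -muE lt_neqAle; apply/andP; split.
      by apply/eqP => E; apply: nB; exists f.
    apply: ereal_sup_le => _ [x [Mx bx] <-].
    by exists x => //; split => // j; exact: bx.
  by move=> /ereal_sup_gt[_ [x fx <-]]; rewrite lte_fin; exists x.
(* There are finitely many selections, so one threshold above [mu] is reached by all the [x f]. *)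
pose mu' := \big[Num.min/mu + 1]_f c (x f).
have mu_mu' : mu < mu'.
  by apply: lt_bigmin => [|f _]; [rewrite ltrDl|have [] := xP f].
pose a o := if o is Some i then b i else fun y => c y - mu'.
have [[i|]||y [My ay]] := condition_A_fin M0 h0 AM _ a.
- exact: affb.
- exact: affine_linear_shift.
- move=> f; have [[j0 fj0]|fN] := pselect (exists j, f j = None).
    (* Slot [j0] is spent on the objective, which leaves [h] slots for constraints. Further copies
       of the objective get an arbitrary index, available by [h <= m]. *)
    pose g := [ffun j => odflt (widen_ord hm j) (f (lift j0 j))].
    have [[Mx bx] _] := xP g; exists (x g); split => // j.
    have cg : 0 <= c (x g) - mu' by rewrite subr_ge0 /mu' bigmin_le.
    case: (unliftP j0 j) => [j'|] ->; last by rewrite fj0.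
    by have := bx j'; rewrite ffunE /a; case: (f _).
  (* A subsystem without the objective is feasible: a finite supremum is not taken over the empty
     set. *)
  have [y [My by_]] : solutions M b !=set0.
    apply/set0P/eqP => b0; move: mu_fin.
    by rewrite /sup_over b0 image_set0 ereal_sup0.
  exists y; split => // j; case E : (f j) => [i|]; first exact: by_.
  by case: fN; exists j.
- have := sol_le y; rewrite leNgt (lt_le_trans mu_mu').
    by move=> H; have := H (conj My (fun i => ay (Some i))).
  by rewrite -subr_ge0; exact: (ay None).
Qed.

(** * From (B) to (A) *)

(** Near each point of [K] a single [a i] stays below half its negative value there, so every small
    [d] works locally; compactness makes the choice uniform. *)
Lemma compact_uniform_gap {R : realType} {T : topologicalType} {I : Type}
    (K : set T) (a : I -> T -> R) :
  compact K -> (forall i, continuous (a i)) ->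
  (forall x, K x -> exists i, a i x < 0) ->
  exists2 d, 0 < d & forall x, K x -> exists i, a i x <= - d.
Proof.
move=> /compact_near_coveringP cK a_cont Ka.
have : \forall d \near 0^'+, K `<=` (fun x => exists i, a i x <= - d).
  apply: cK => x /Ka[i aix].
  exists ([set y | a i y < a i x / 2], [set d | d < - (a i x / 2)]) => /=.
    split.
      by apply: (cvgr_lt _ (a_cont i x)); lra.
    by apply: nbhs_right_lt; lra.
  move=> [y d] /= [ay dx]; exists i; lra.
move=> Kd; near (0 : R)^'+ => d.
exists d; first by near: d; exact: nbhs_right_gt.
by near: d.
Unshelve. all: by end_near. Qed.

(* If relaxing all but one constraint by d / 2 keeps them feasible, (B) applies
   with the remaining constraint as objective, whose supremum is at most - d;
   otherwise that constraint can be dropped at the cost of halving the gap. *)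
Lemma condition_B_gap {R : realType} {k : nat} {M : set 'rV[R]_k} {h : nat} :
  M !=set0 -> condition_B M h.+1 ->
  forall (n : nat) (a : 'I_n -> 'rV[R]_k -> R) (d : R), 0 < d ->
    (forall i, affine_linear (a i)) ->
    (forall x, M x -> exists i, a i x <= - d) ->
    exists f : 'I_h.+1 -> 'I_n, ~ (solutions M (fun j => a (f j)) !=set0).
Proof.
move=> [x0 Mx0] BM; elim=> [|n IH] a d d0 aff gap.
  by have [[]] := gap _ Mx0.
have [nh|hn] := ltnP n h.
  (* The whole system has at most [h] members, so the selection runs through all of them. *)
  exists (fun j => inord j) => -[x [Mx ax]].
  have [i] := gap x Mx; apply/negP; rewrite -ltNge.
  have := ax (inord i); rewrite !inordK ?inord_val; first lra.
  by rewrite ltnS ltnW// (leq_ltn_trans _ nh)// -ltnS.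
(* A value at most [- d] stays negative after adding [d / 2], so at a relaxed solution the gap can
   only come from [a ord0]. *)
pose b i x := a (lift ord0 i) x + d / 2.
have affb i : affine_linear (b i) by exact: affine_linear_shift.
have [[x1 [Mx1 bx1]]|bN] := pselect (solutions M b !=set0); last first.
  have [|||f fN] := IH (fun i => a (lift ord0 i)) (d / 2).
  - by rewrite divr_gt0.
  - by move=> i; exact: aff.
  - move=> x Mx; apply: contrapT => nx; apply: bN; exists x; split => // i.
    by rewrite /b -[_ + _]opprK oppr_ge0 leNgt; apply/negP => ?; apply: nx; exists i; lra.
  - by exists (fun j => lift ord0 (f j)).
have sol_le x : solutions M b x -> a ord0 x <= - d.
  move=> [Mx bx]; have [i] := gap x Mx.
  case: (unliftP ord0 i) => [j|] -> // aj.
  by have := bx j; rewrite /b; lra.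
have sup_le : (sup_over M b (a ord0) <= (- d)%:E)%E.
  by apply: ge_ereal_sup => _ [x /sol_le xd <-]; rewrite lee_fin.
have sup_ge : ((a ord0 x1)%:E <= sup_over M b (a ord0))%E.
  by apply: ereal_sup_ubound; exists x1.
have mu_fin : sup_over M b (a ord0) \is a fin_num.
  rewrite fin_numE; apply/andP; split.
    by rewrite gt_eqF// (lt_le_trans _ sup_ge)// ltNyr.
  by rewrite lt_eqF// (le_lt_trans sup_le)// ltry.
have [g gE] := BM n b (a ord0) hn affb (aff ord0) mu_fin.
exists (fun j => if unlift ord0 j is Some i then lift ord0 (g i) else ord0).
move=> [x [Mx ax]].
have a0 : 0 <= a ord0 x by have := ax ord0; rewrite unlift_none.
have : ((a ord0 x)%:E <= sup_over M b (a ord0))%E.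
  rewrite gE; apply: ereal_sup_ubound; exists x => //; split => // j.
  by have := ax (lift ord0 j); rewrite liftK /b; lra.
by move=> /le_trans /(_ sup_le); rewrite lee_fin; lra.
Qed.

(* Box constraints enclosing chosen solutions of all the h-subsystems keep these
   feasible, and with M closed they turn infeasibility into a uniform gap. *)
Lemma condition_B_A {R : realType} {k : nat} (M : set 'rV[R]_k) (h : nat) :
  M !=set0 -> closed M -> (0 < h)%N -> condition_B M h -> condition_A M h.
Proof.
case: h => // h M0 clM _ BM m a hm aff.
have [|feas] := pselect (exists i : 'I_h.+1 -> 'I_m,
  ~ (solutions M (fun j => a (i j)) !=set0)); first by right.
left; apply: contrapT => infeas.
have /choice[x xP] : forall f : {ffun 'I_h.+1 -> 'I_m}, exists x,
    solutions M (fun j => a (f j)) x.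
  by move=> f; apply: contrapT => nx; apply: feas; exists f.
pose N := \big[Num.max/0]_(p : {ffun 'I_h.+1 -> 'I_m} * 'I_k) `|x p.1 0 p.2|.
have xN f j : `|x f 0 j| <= N.
  exact: (le_bigmax _ (fun p : {ffun 'I_h.+1 -> 'I_m} * 'I_k => `|x p.1 0 p.2|) (f, j)).
(* The sign given by [p.2] yields both halves of the bound [N] on the absolute value of a
   coordinate. *)
pose box (p : 'I_k * bool) (y : 'rV[R]_k) := (-1) ^+ p.2 * y 0 p.1 + N.
pose a' (t : 'I_m + 'I_k * bool) := match t with inl i => a i | inr p => box p end.
have aff' t : affine_linear (a' t).
  case: t => [i|p] /=; first exact: aff.
  have -> : box p = fun y => (y *m ((-1) ^+ p.2 *: delta_mx p.1 0 : 'cV_k)) 0 0 + N.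
    by apply/funext => y; rewrite -scalemxAr -colE !mxE.
  exact: affine_linear_row.
have [d d0 gap] : exists2 d, 0 < d & forall y, M y -> exists t, a' t y <= - d.
  (* The cube exceeds the box by 1: on [M] outside it some box constraint is at most -1, and inside
     it compactness gives the gap. *)
  pose Q := [set y : 'rV[R]_k | forall j, `[- (N + 1), N + 1]%classic (y ord0 j)].
  have cQ : compact (Q `&` M).
    apply: compact_closedI => //; apply: (@rV_compact _ _ (fun=> _)) => _.
    exact: segment_compact.
  have [|y [_ My]|d d0 dP] := compact_uniform_gap _ a' cQ.
  - by move=> t; exact: affine_linear_continuous.
  - apply: contrapT => ny; apply: infeas; exists y; split => // i.
    by rewrite leNgt; apply/negP => ?; apply: ny; exists (inl i).
  exists (Num.min d 1) => [|y My]; first by rewrite lt_min d0 ltr01.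
  have [Qy|] := pselect (Q y).
    have [t td] := dP y (conj Qy My); exists t; apply: (le_trans td).
    by rewrite lerN2 ge_min lexx.
  move=> /existsNP[j]; rewrite /= in_itv/= => /negP; rewrite negb_and -!ltNge.
  move=> yj; suff [p yp] : exists p, box p y <= -1.
    by exists (inr p); apply: (le_trans yp); rewrite lerN2 ge_min lexx orbT.
  case/orP: yj => yj; [exists (j, false)|exists (j, true)];
    by rewrite /box /= ?expr0 ?expr1; lra.
have [|||f []] :=
  condition_B_gap M0 BM #|{: 'I_m + 'I_k * bool}| (fun j => a' (enum_val j)) d.
- by [].
- by move=> j; exact: aff'.
- by move=> y /gap[t td]; exists (enum_rank t); rewrite enum_rankK.
(* Selected box constraints are replaced by the index 0, since every [x g] satisfies all of them by
   the choice of [N]. *)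
pose g := [ffun j => if enum_val (f j) is inl i then i
                     else Ordinal (leq_trans (ltn0Sn h) hm)].
have [Mx ax] := xP g; exists (x g); split => // j.
have := ax j; rewrite ffunE; case: (enum_val (f j)) => //= -[l s] _.
by have := xN g l; rewrite ler_norml /box; case: s => /=; rewrite ?expr0 ?expr1; lra.
Qed.

Theorem proposition1p2 (R : realType) (k : nat) (M : set 'rV[R]_k) (h : nat)
    (M_neq0 : M !=set0) (M_closed : closed M) (h_ge1 : (1 <= h)%N) :
  (condition_H M h <-> condition_A M h) /\
  (condition_A M h <-> condition_B M h).
Proof.
split; split.
- exact: condition_H_A.
- exact: condition_A_H.
- exact: condition_A_B.
- exact: condition_B_A.
Qed.
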